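(* Let $\mathbf{S}$ be a surreal substructure and let $\Pi$ be a thin convex partition of $\mathbf{S}$, with a chosen family $(\tilde\Pi[x])_{x\in\mathbf{S}}$ such that each $\tilde\Pi[x]$ is a subset of $\Pi[x]$ that is both cofinal and coinitial in $\Pi[x]$, and $\tilde\Pi[x]=\tilde\Pi[y]$ iff $\Pi[x]=\Pi[y]$. Then the class $\mathbf{Smp}_\Pi$ of $\Pi$-simple elements is a surreal substructure, and for all subsets $L<R$ of $\mathbf{Smp}_\Pi$, the number $\{\tilde\Pi[L]\mid\tilde\Pi[R]\}_{\mathbf{S}}$ is well defined and $$\{L\mid R\}_{\mathbf{Smp}_\Pi}=\{\tilde\Pi[L]\mid\tilde\Pi[R]\}_{\mathbf{S}},$$ where $\tilde\Pi[X]:=\bigcup_{x\in X}\tilde\Pi[x]$.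
   Context: Surreal numbers are maps $x:\ell(x)\to\{-1,1\}$, $\ell(x)$ an ordinal; $\mathbf{No}$ is their class, ordered lexicographically (padding with $0$, $-1<0<1$). Simplicity: $x\sqsubseteq y$ iff $y$ restricted to $\ell(x)$ equals $x$. A surreal substructure is the image of a map $f:\mathbf{No}\to\mathbf{No}$ with $x\le y\iff f(x)\le f(y)$ and $x\sqsubseteq y\iff f(x)\sqsubseteq f(y)$. For classes $\mathbf{A},\mathbf{B}$, $\mathbf{A}<\mathbf{B}$ means $a<b$ for all $a\in\mathbf{A},b\in\mathbf{B}$. For a class $\mathbf{T}$ and sets $L<R$, $\{L\mid R\}_{\mathbf{T}}$ denotes the $\sqsubseteq$-least element (root) of $\{x\in\mathbf{T}:L<x<R\}$, when it exists. A convex partition $\Pi$ of $\mathbf{S}$ is a partition of $\mathbf{S}$ into classes $C$ convex in $\mathbf{S}$ (if $x,z\in C$, $y\in\mathbf{S}$, $x\le y\le z$ then $y\in C$); $\Pi[x]$ denotes the member containing $x$; each member has a $\sqsubseteq$-least element. An element $x\in\mathbf{S}$ is $\Pi$-simple if it is the $\sqsubseteq$-least element of $\Pi[x]$. $\Pi$ is thin if each member of $\Pi$ has a subset (a set) that is cofinal and coinitial in it. *)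

(* Defs.v *)
From mathcomp Require Import all_boot all_order all_algebra.
From mathcomp Require Import boolp classical_sets.

Set Implicit Arguments.
Unset Strict Implicit.
Unset Printing Implicit Defensive.

Local Open Scope classical_set_scope.

(* A fixed universe: sets are (images of) types in [Small]. The types [Ord] and
   [No] below live strictly above it, and classes are predicates on [No]. *)
Definition Small := Type.

(* Ordinals are ranks of well-founded trees with set-sized branching, where
   rank (Node f) = sup_i (rank (f i) + 1). Hence [tree_le] compares ranks, and
   [Ord] is the quotient of [tree] by equality of ranks, realised by
   equivalence classes so that equality on [Ord] is Leibniz equality. *)
Inductive tree : Type := Node (A : Small) (f : A -> tree).

Fixpoint tree_le (s t : tree) : Prop :=
  match s, t with
  | Node A f, Node B g => forall i : A, exists j : B, tree_le (f i) (g j)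
  end.

Definition tree_lt (s t : tree) : Prop :=
  match t with Node B g => exists j : B, tree_le s (g j) end.

Definition same_rank (s t : tree) : Prop := tree_le s t /\ tree_le t s.

Record Ord : Type := MkOrd {
  rank_class : set tree;
  rank_classP : exists t, rank_class = [set s | same_rank t s]
}.

Definition ord_lt (a b : Ord) : Prop :=
  exists s t, [/\ rank_class a s, rank_class b t & tree_lt s t].

Definition ord_le (a b : Ord) : Prop := a = b \/ ord_lt a b.

(* In [sgn], [true] encodes 1 and [false] encodes -1. *)
Record No : Type := MkNo {
  len : Ord;
  sgn : {b : Ord | ord_lt b len} -> bool
}.

Definition padded (x : No) (b : Ord) : int :=
  match pselect (ord_lt b (len x)) with
  | left lt_b => if sgn (exist _ b lt_b) then 1%R else (-1)%R
  | right _ => 0%R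
  end.

Definition no_lt (x y : No) : Prop :=
  exists b, (forall c, ord_lt c b -> padded x c = padded y c) /\
            (padded x b < padded y b)%R.

Definition no_le (x y : No) : Prop := x = y \/ no_lt x y.

Definition simpler (x y : No) : Prop :=
  ord_le (len x) (len y) /\
  forall b, ord_lt b (len x) -> padded y b = padded x b.

Definition is_set (X : set No) : Prop :=
  exists (A : Small) (f : A -> No), X = range f.

Definition class_lt (A B : set No) : Prop :=
  forall a b, A a -> B b -> no_lt a b.

Definition surreal_substructure (S : set No) : Prop :=
  exists f : No -> No,
    [/\ forall x y, no_le x y <-> no_le (f x) (f y),
        forall x y, simpler x y <-> simpler (f x) (f y)
      & S = range f].

Definition is_root (T : set No) (x : No) : Prop :=
  T x /\ forall y, T y -> simpler x y.

(* [is_cut T L R x] reads: {L | R}_T is well defined and equal to x. *)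
Definition is_cut (T L R : set No) (x : No) : Prop :=
  [/\ is_set L, is_set R, class_lt L R
    & is_root [set y | [/\ T y, class_lt L [set y] & class_lt [set y] R]] x].

Definition convex_in (S C : set No) : Prop :=
  forall x y z, C x -> C z -> S y -> no_le x y -> no_le y z -> C y.

Definition convex_partition (S : set No) (Pi : set (set No)) : Prop :=
  [/\ forall C, Pi C -> [/\ C !=set0, C `<=` S & convex_in S C],
      forall C D, Pi C -> Pi D -> C `&` D !=set0 -> C = D
    & forall x, S x -> exists2 C, Pi C & C x].

(* The member of Pi containing x: when Pi is a partition of S and x is in S,
   exactly one C contributes to this union. *)
Definition member (Pi : set (set No)) (x : No) : set No :=
  \bigcup_(C in [set C | Pi C /\ C x]) C.

Definition cofinal (C X : set No) : Prop :=
  forall c, C c -> exists2 x, X x & no_le c x.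

Definition coinitial (C X : set No) : Prop :=
  forall c, C c -> exists2 x, X x & no_le x c.

Definition thin (Pi : set (set No)) : Prop :=
  forall C, Pi C ->
    exists X, [/\ is_set X, X `<=` C, cofinal C X & coinitial C X].

Definition Smp (S : set No) (Pi : set (set No)) : set No :=
  [set x | S x /\ is_root (member Pi x) x].

(* Adequacy of the encodings: [Ord] is a well-ordered class whose initial
   segments are sets and in which every set is strictly bounded, and
   {L | R}_T has at most one value. *)

Lemma tree_le_refl t : tree_le t t.
Proof. by elim: t => A f IH /= i; exists i. Qed.

Lemma tree_le_trans s t u : tree_le s t -> tree_le t u -> tree_le s u.
Proof.
elim: s t u => I f IH [J g] [K h] /= st tu i.
by have [j ij] := st i; have [k jk] := tu j; exists k; apply: IH ij jk.
Qed.

Lemma tree_ltNle s t : tree_lt s t <-> ~ tree_le t s.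
Proof.
elim: s t => I f IH [J g] /=; split.
- move=> [j sj] ts; have [i ji] := ts j.
  case E: (g j) sj ji => [K h] /= sj ji.
  by have := (IH i (Node h)).1; apply=> //=; apply: sj.
- move=> nts; apply: contrapT => nlt; apply: nts => j.
  apply: contrapT => nji; apply: nlt; exists j.
  case E: (g j) nji => [K h] nji i.
  by apply/(IH i (Node h)); move=> le; apply: nji; exists i.
Qed.

Lemma tree_ltW s t : tree_lt s t -> tree_le s t.
Proof.
elim: s t => I f IH [J g] [j] /= sj i.
case E: (g j) sj => [K h] /= sj; exists j; rewrite E.
exact: (IH i (Node h) (sj i)).
Qed.

Lemma tree_le_lt_trans s t u : tree_le s t -> tree_lt t u -> tree_lt s u.
Proof.
by case: u => K h st [k tk]; exists k; apply: tree_le_trans st tk.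
Qed.

Lemma tree_lt_le_trans s t u : tree_lt s t -> tree_le t u -> tree_lt s u.
Proof.
case: t u => [J g] [K h] [j sj] tu; have [k jk] := tu j.
by exists k; apply: tree_le_trans sj jk.
Qed.

Definition rank (t : tree) : Ord :=
  @MkOrd [set s | same_rank t s] (ex_intro _ t erefl).

Lemma rank_surj a : exists t, a = rank t.
Proof.
case: a => P aP; have [t Pt] := aP; exists t; move: aP; rewrite Pt => aP.
by rewrite /rank; congr MkOrd; apply: Prop_irrelevance.
Qed.

Lemma rank_eq s t : same_rank s t -> rank s = rank t.
Proof.
move=> [st ts]; have E : [set u | same_rank s u] = [set u | same_rank t u].
  apply/seteqP; split=> u [h k]; split.
  - exact: tree_le_trans ts h.
  - exact: tree_le_trans k st.
  - exact: tree_le_trans st h.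
  - exact: tree_le_trans k ts.
rewrite /rank; move: (ex_intro _ s _) (ex_intro _ t _); rewrite E => p q.
by congr MkOrd; apply: Prop_irrelevance.
Qed.

Lemma ord_lt_rank s t : ord_lt (rank s) (rank t) <-> tree_lt s t.
Proof.
split=> [[s' [t' [[ss' _] [_ t't] lt]]]|lt].
  exact: tree_lt_le_trans (tree_le_lt_trans ss' lt) t't.
by exists s, t; split=> //; split; apply: tree_le_refl.
Qed.

Lemma ord_lt_trans a b c : ord_lt a b -> ord_lt b c -> ord_lt a c.
Proof.
have [[s ->] [t ->] [u ->]] := And3 (rank_surj a) (rank_surj b) (rank_surj c).
rewrite !ord_lt_rank => st tu; exact: tree_le_lt_trans (tree_ltW st) tu.
Qed.

Lemma ord_lt_total a b : [\/ ord_lt a b, a = b | ord_lt b a].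
Proof.
have [[s ->] [t ->]] := conj (rank_surj a) (rank_surj b).
have [st|/tree_ltNle ts] := pselect (tree_le s t); last first.
  by constructor 3; apply/ord_lt_rank.
have [ts|/tree_ltNle lt] := pselect (tree_le t s).
  by constructor 2; apply: rank_eq.
by constructor 1; apply/ord_lt_rank.
Qed.

Lemma ord_lt_wf : well_founded ord_lt.
Proof.
suff H t s : tree_le s t -> Acc ord_lt (rank s).
  by move=> a; have [t ->] := rank_surj a; apply: H (tree_le_refl t).
elim: t s => J g IH s st; constructor=> a.
have [u ->] := rank_surj a; rewrite ord_lt_rank => us.
by have [j uj] := tree_lt_le_trans us st; apply: IH uj.
Qed.

Lemma ord_initial_small a :
  exists (A : Small) (f : A -> Ord), [set b | ord_lt b a] `<=` range f.
Proof.
have [t ->] := rank_surj a; elim: t => J g IH.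
have /choice [F HF] : forall j, exists p : {I : Small & I -> Ord},
    [set b | ord_lt b (rank (g j))] `<=` range (projT2 p).
  by move=> j; have [I [f]] := IH j; exists (existT _ I f).
exists ({j : J & projT1 (F j)} + J)%type.
exists (fun x => match x with
  | inl p => projT2 (F (projT1 p)) (projT2 p)
  | inr j => rank (g j) end).
move=> b /=; have [s ->] := rank_surj b; rewrite ord_lt_rank => -[j sj].
have [js|/tree_ltNle lt] := pselect (tree_le (g j) s).
  by exists (inr j) => //; apply: rank_eq.
have [i _ Ei] := HF j (rank s) ((ord_lt_rank _ _).2 lt).
by exists (inl (existT _ j i)).
Qed.

Lemma ord_small_bounded (A : Small) (f : A -> Ord) :
  exists a, forall i, ord_lt (f i) a.
Proof.
have /choice [g fg] := fun i => rank_surj (f i).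
exists (rank (Node g)) => i; rewrite fg ord_lt_rank; exists i.
exact: tree_le_refl.
Qed.

Lemma ord_lt_irr a : ~ ord_lt a a.
Proof.
have [t ->] := rank_surj a; rewrite ord_lt_rank tree_ltNle; apply.
exact: tree_le_refl.
Qed.

Lemma padded_inj x y : len x = len y -> padded x =1 padded y -> x = y.
Proof.
case: x y => [a s] [b t] /= E; move: E t => <- t st; congr MkNo.
apply/funext=> -[c ca]; have := st c; rewrite /padded /=.
case: pselect => // ca'; rewrite (Prop_irrelevance ca ca').
by case: (s _); case: (t _).
Qed.

Lemma simpler_anti x y : simpler x y -> simpler y x -> x = y.
Proof.
move=> [xy Exy] [yx _]; have E : len x = len y.
  case: xy yx => [//|xy] [//|yx].
  by case: (ord_lt_irr (ord_lt_trans xy yx)).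
apply: padded_inj => // b.
have [bx|bx] := pselect (ord_lt b (len x)); first by rewrite Exy.
by rewrite /padded; case: pselect => //; case: pselect => //; rewrite E.
Qed.

Lemma is_cut_unique T L R x y : is_cut T L R x -> is_cut T L R y -> x = y.
Proof.
move=> [_ _ _ [Tx xmin]] [_ _ _ [Ty ymin]].
by apply: simpler_anti; [apply: xmin | apply: ymin].
Qed.

(* Main.v *)
Require Import Defs.
From mathcomp Require Import all_boot all_order all_algebra.
From mathcomp Require Import boolp classical_sets.
From Stdlib Require Import Inverse_Image.

Local Open Scope classical_set_scope.

Import Order.TTheory.

(* A convex class in a surreal substructure has a root, namely its element of
   least length: the longest common initial segment of two numbers lies between
   them. Conversely, a class T in which every cut {L | R}_T of sets has a root is
   a surreal substructure, via f {L | R} = {f L | f R}_T. So only the cuts of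
   Smp have to be found. Given sets L < R of simple elements, distinct members of
   Pi are comparable by convexity, so z = {tPi[L] | tPi[R]}_S exists; by
   cofinality Pi[L] < Pi[z] < Pi[R], so the root of Pi[z] lies in the same cut
   and equals z, i.e. z is simple. *)

(** * Well-founded minima and recursion *)

Lemma wf_min {A : Type} {lt : A -> A -> Prop} (wf : well_founded lt)
    (P : A -> Prop) :
  (exists a, P a) -> exists2 a, P a & forall b, lt b a -> ~ P b.
Proof.
move=> [a Pa]; apply: contrapT => nmin.
suff: ~ P a by [].
elim/(well_founded_ind wf): a {Pa} => a IH Pa.
by apply: nmin; exists a.
Qed.

(** The default [d] answers calls at arguments not below [x], so that [F] takes a total function and
    calls carry no proof. *)
Lemma wf_rec {A B : Type} {lt : A -> A -> Prop} (wf : well_founded lt)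
    (d : B) (F : A -> (A -> B) -> B) :
  exists f : A -> B,
    forall x, f x = F x (fun y => if pselect (lt y x) then f y else d).
Proof.
pose G x (r : forall y, lt y x -> B) :=
  F x (fun y => match pselect (lt y x) with left h => r y h | right _ => d end).
exists (Fix wf (fun=> B) G) => x; rewrite Fix_eq; last first.
  move=> a r r' rr'; rewrite /G; congr F; apply/funext => y.
  by case: pselect.
by rewrite /G; congr F; apply/funext => y; case: pselect.
Qed.

(** * Padded signs, the linear order and simplicity *)

Lemma ord_leNgt a b : ord_le a b <-> ~ ord_lt b a.
Proof.
split=> [[->|ab] ba|]; first exact: ord_lt_irr ba.
  exact: ord_lt_irr (ord_lt_trans ab ba).
by case: (ord_lt_total a b) => [||ba //]; [right|left].
Qed.

Lemma ord_le_lt_trans a b c : ord_le a b -> ord_lt b c -> ord_lt a c.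
Proof. by move=> [->//|ab]; apply: ord_lt_trans. Qed.

Lemma padded_neq0 x b : padded x b <> 0%R <-> ord_lt b (len x).
Proof.
rewrite /padded; case: pselect => [h|h]; last by split.
by case: (sgn _); split.
Qed.

Lemma padded_out x b : ~ ord_lt b (len x) -> padded x b = 0%R.
Proof. by move=> h; apply: contrapT => /padded_neq0. Qed.

Lemma padded_cases x b :
  [\/ padded x b = (-1)%R, padded x b = 0%R | padded x b = 1%R].
Proof.
rewrite /padded; case: pselect => h; last by constructor 2.
by case: (sgn _); [constructor 3 | constructor 1].
Qed.

Lemma padded0_le x b c : padded x b = 0%R -> ord_le b c -> padded x c = 0%R.
Proof.
move=> x0 bc; apply: contrapT => /padded_neq0 cx.
by case/padded_neq0: (ord_le_lt_trans _ _ _ bc cx).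
Qed.

Lemma no_ext x y : padded x =1 padded y -> x = y.
Proof.
move=> E; apply: padded_inj => //.
have H u v : padded u =1 padded v -> ~ ord_lt (len u) (len v).
  by move=> uv /padded_neq0; rewrite -uv padded_out //; apply: ord_lt_irr.
by case: (ord_lt_total (len x) (len y)) => // [/H|/H]; case.
Qed.

Lemma no_lt_irr x : ~ no_lt x x.
Proof. by move=> [b [_]]; rewrite ltxx. Qed.

Lemma no_lt_trans x y z : no_lt x y -> no_lt y z -> no_lt x z.
Proof.
move=> [b [xy xyb]] [c [yz yzc]].
case: (ord_lt_total b c) => [bc|E|cb].
- exists b; split=> [d db|]; last by rewrite -(yz b).
  by rewrite xy // yz //; apply: ord_lt_trans bc.
- subst c; exists b; split=> [d db|]; first by rewrite xy // yz.
  exact: lt_trans yzc.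
- exists c; split=> [d dc|]; last by rewrite xy.
  by rewrite xy ?yz //; apply: ord_lt_trans cb.
Qed.

Lemma no_lt_total x y : [\/ no_lt x y, x = y | no_lt y x].
Proof.
have [E|/existsNP nE] := pselect (padded x =1 padded y).
  by constructor 2; apply: no_ext.
have [b nb minb] := wf_min ord_lt_wf _ nE.
have E c : ord_lt c b -> padded x c = padded y c by move/minb/contrapT.
have : (padded x b != padded y b)%R by apply/eqP.
rewrite neq_lt => /orP[lt|lt]; first by constructor 1; exists b.
by constructor 3; exists b; split=> // c /E.
Qed.

Lemma no_leNgt x y : no_le x y <-> ~ no_lt y x.
Proof.
split=> [[->|xy] yx|]; first exact: no_lt_irr yx.
  exact: no_lt_irr (no_lt_trans _ _ _ xy yx).
by case: (no_lt_total x y) => [||yx //]; [right|left].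
Qed.

Lemma no_le_lt_trans x y z : no_le x y -> no_lt y z -> no_lt x z.
Proof. by move=> [->//|xy]; apply: no_lt_trans. Qed.

Lemma no_lt_le_trans x y z : no_lt x y -> no_le y z -> no_lt x z.
Proof. by move=> xy [<-//|]; apply: no_lt_trans. Qed.

(** Agreement below [len x] already bounds the length: [y] is padded by 0 at [len y], whereas [x]
    has no zero below [len x]. *)
Lemma simplerP x y :
  simpler x y <-> forall b, ord_lt b (len x) -> padded y b = padded x b.
Proof.
split=> [[]//|H]; split=> //; apply/ord_leNgt => yx.
by have /padded_neq0 := yx; rewrite -H // padded_out //; apply: ord_lt_irr.
Qed.

Lemma simpler_refl x : simpler x x.
Proof. by apply/simplerP. Qed.

Lemma simpler_trans x y z : simpler x y -> simpler y z -> simpler x z.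
Proof.
move=> /simplerP xy /simplerP yz; apply/simplerP => b bx.
rewrite yz ?xy //; apply/padded_neq0; rewrite xy //; exact/padded_neq0.
Qed.

Lemma simpler_len_eq x y : simpler x y -> len x = len y -> x = y.
Proof.
move=> xy E; apply: simpler_anti => //; split; first by left.
by move=> b; rewrite -E => /(xy.2 b).
Qed.

Lemma simpler_neq_len x y : simpler x y -> x <> y -> ord_lt (len x) (len y).
Proof. by move=> xy ne; case: xy.1 => // /(simpler_len_eq _ _ xy). Qed.

(* A proper initial segment lies on the side of its extension that is opposite
   to the next sign. *)
Lemma simpler_lt x y : simpler x y ->
  (no_lt x y <-> padded y (len x) = 1%R) /\
  (no_lt y x <-> padded y (len x) = (-1)%R).
Proof.
move=> xy; have E b : ord_lt b (len x) -> padded x b = padded y b.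
  by move=> bx; rewrite xy.2.
have x0 : padded x (len x) = 0%R by apply/padded_out/ord_lt_irr.
have lt1 : padded y (len x) = 1%R -> no_lt x y.
  by move=> y1; exists (len x); rewrite x0 y1.
have ltN1 : padded y (len x) = (-1)%R -> no_lt y x.
  by move=> y1; exists (len x); rewrite x0 y1; split=> // c /E.
have eq0 : padded y (len x) = 0%R -> x = y.
  move=> y0; apply: no_ext => b.
  have [/E//|nb] := pselect (ord_lt b (len x)).
  by rewrite padded_out // (padded0_le _ _ _ y0) //; apply/ord_leNgt.
case: (padded_cases y (len x)) => h; rewrite h; split; split=> // lt.
- by case: (no_lt_irr _ (no_lt_trans _ _ _ lt (ltN1 h))).
- exact: ltN1.
- by move: lt; rewrite (eq0 h) => /no_lt_irr.
- by move: lt; rewrite (eq0 h) => /no_lt_irr.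
- exact: lt1.
- by case: (no_lt_irr _ (no_lt_trans _ _ _ lt (lt1 h))).
Qed.

(** The sign at position [len x] decides the comparison with [x], and [z] inherits it from [y]. *)
Lemma simpler_lt_trans x y z :
  simpler x y -> simpler y z -> no_lt x y -> no_lt x z.
Proof.
move=> xy yz /(simpler_lt _ _ xy).1 y1.
apply/(simpler_lt _ _ (simpler_trans _ _ _ xy yz)).1.
by rewrite yz.2 //; apply/padded_neq0; rewrite y1.
Qed.

Lemma simpler_gt_trans x y z :
  simpler x y -> simpler y z -> no_lt y x -> no_lt z x.
Proof.
move=> xy yz /(simpler_lt _ _ xy).2 y1.
apply/(simpler_lt _ _ (simpler_trans _ _ _ xy yz)).2.
by rewrite yz.2 //; apply/padded_neq0; rewrite y1.
Qed.

(** * Truncated sign sequences and longest common prefixes *)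

(** A sign for every ordinal describes a branch through the whole tree of numbers; the numbers on it
    are the truncations of [s]. *)
Definition sign_seq (s : Ord -> bool) (b : Ord) : No :=
  @MkNo b (fun p => s (sval p)).

Lemma padded_sign_seq s b c : ord_lt c b ->
  padded (sign_seq s b) c = if s c then 1%R else (-1)%R.
Proof. by move=> cb; rewrite /padded; case: pselect. Qed.

Lemma sign_seq_simpler s b c : ord_le b c ->
  simpler (sign_seq s b) (sign_seq s c).
Proof.
move=> bc; split=> // d /= db; rewrite !padded_sign_seq //.
by case: bc db => [->//|bc db]; apply: ord_lt_trans bc.
Qed.

Lemma sign_seq_lt s b c : ord_lt b c ->
  (no_lt (sign_seq s b) (sign_seq s c) <-> s b) /\
  (no_lt (sign_seq s c) (sign_seq s b) <-> ~~ s b).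
Proof.
move=> bc; have [-> ->] := simpler_lt _ _ (sign_seq_simpler s _ _ (or_intror bc)).
by rewrite padded_sign_seq //=; case: (s b).
Qed.

Definition signs (x : No) (b : Ord) : bool := (padded x b == 1)%R.

Lemma padded_signs x b : padded x b <> 0%R ->
  padded x b = if signs x b then 1%R else (-1)%R.
Proof. by rewrite /signs; case: (padded_cases x b) => ->. Qed.

Lemma simpler_sign_seq s x b : simpler x (sign_seq s b) ->
  x = sign_seq s (len x).
Proof.
move=> xs; apply: simpler_len_eq => //; apply/simplerP => c cx.
rewrite padded_sign_seq // -xs.2 // padded_sign_seq //.
by case: xs.1 cx => /= [->//|xb cx]; apply: ord_lt_trans xb.
Qed.

Lemma sign_seq_signs x : sign_seq (signs x) (len x) = x.
Proof.
apply: simpler_len_eq => //; apply/simplerP => c /= cx.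
by rewrite padded_sign_seq // padded_signs //; apply/padded_neq0.
Qed.

(** The witness is [x] cut off at the first disagreement [b]; the values at [b] place it weakly
    between [x] and [y]. *)
Lemma no_lt_meet x y : no_lt x y ->
  exists z, [/\ simpler z x, simpler z y, no_le x z & no_le z y].
Proof.
move=> [b [E lt]]; set z := sign_seq (signs x) b.
(* A zero of [x] before [b] would be shared by [y], and both would then vanish at [b]. *)
have xN0 c : ord_lt c b -> padded x c <> 0%R.
  move=> cb x0; move: lt; rewrite (padded0_le _ _ _ x0 (or_intror cb)).
  by rewrite (padded0_le y _ _ _ (or_intror cb)) // -E.
have zx : simpler z x.
  apply/simplerP => c /= cb; rewrite padded_sign_seq // padded_signs //.
  exact: xN0.
have zy : simpler z y.
  by apply/simplerP => c /= cb; rewrite -E // zx.2.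
exists z; split=> //.
- apply/no_leNgt; rewrite (simpler_lt _ _ zx).1 /= => x1.
  by move: lt; rewrite x1; case: (padded_cases y b) => ->.
- apply/no_leNgt; rewrite (simpler_lt _ _ zy).2 /= => y1.
  by move: lt; rewrite y1; case: (padded_cases x b) => ->.
Qed.

(** * Roots of convex classes *)

Lemma convex_root (C : set No) : C !=set0 -> convex_in setT C ->
  exists x, is_root C x.
Proof.
move=> [x0 Cx0] cC.
have [b [x Cx xb] minb] : exists2 b, (exists2 x, C x & len x = b) &
    forall c, ord_lt c b -> ~ (exists2 x, C x & len x = c).
  by apply: wf_min ord_lt_wf _ _; exists (len x0), x0.
exists x; split=> // y Cy.
(* As [x] has least length in [C], a prefix of [x] that lies in [C] is [x] itself. *)
suff [z [Cz zx zy]] : exists z, [/\ C z, simpler z x & simpler z y].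
  have [<-//|ne] := pselect (z = x).
  by case: (minb (len z)); [rewrite -xb; apply: simpler_neq_len | exists z].
case: (no_lt_total x y) => [lt|E|lt].
- have [z [zx zy xz zy']] := no_lt_meet _ _ lt.
  by exists z; split=> //; apply: (cC x z y).
- by exists x; split=> //; rewrite -?E //; apply: simpler_refl.
- have [z [zy zx yz zx']] := no_lt_meet _ _ lt.
  by exists z; split=> //; apply: (cC y z x).
Qed.

(** * Closure properties of sets *)

Lemma is_set_subset (A : Small) (g : A -> No) (X : set No) :
  X `<=` range g -> is_set X.
Proof.
move=> Xg; exists {a | X (g a)}, (fun p => g (sval p)).
apply/seteqP; split=> [x Xx|_ [[a Xa] _ <-]//].
by have [a _ E] := Xg x Xx; rewrite -E in Xx *; exists (exist _ a Xx).
Qed.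

Lemma is_set_bigcup (X : set No) (F : No -> set No) : is_set X ->
  (forall x, X x -> is_set (F x)) -> is_set (\bigcup_(x in X) F x).
Proof.
move=> [A [g ->]] FS.
have /choice [h Fh] : forall a, exists p : {I : Small & I -> No},
    F (g a) = range (projT2 p).
  by move=> a; have [|I [h E]] := FS (g a); [exists a | exists (existT _ I h)].
apply: (@is_set_subset {a : A & projT1 (h a)}
  (fun p => projT2 (h (projT1 p)) (projT2 p))).
move=> y [_ [a _ <-]]; rewrite Fh => -[i _ <-].
by exists (existT _ a i).
Qed.

Lemma is_set_len_bounded (X : set No) : is_set X ->
  exists a, forall x, X x -> ord_lt (len x) a.
Proof.
move=> [A [g ->]]; have [a ga] := @ord_small_bounded A (fun i => len (g i)).
by exists a => _ [i _ <-].
Qed.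

(** * Numbers between two sets *)

(** Each sign is dictated by the sequence built so far, so recursion runs the rule [F] through all
    ordinals. *)
Lemma follow_strategy (F : No -> bool) :
  exists s : Ord -> bool, forall b, s b = F (sign_seq s b).
Proof.
have [s sE] := wf_rec ord_lt_wf false (fun b s => F (sign_seq s b)).
(* The truncation at [b] reads [s] only below [b], so the default [false] is never seen. *)
exists s => b; rewrite {1}sE; congr (F _); rewrite /sign_seq; congr MkNo.
by apply/funext => -[c cb] /=; case: pselect.
Qed.

(* Starting from the empty sequence, append + below some element of L and -
   above some element of R. If this never stops between L and R, it has done
   so anyway once the sequence is longer than all elements of L and R. *)
Lemma between_sets (L R : set No) : is_set L -> is_set R -> class_lt L R ->
  exists x, class_lt L [set x] /\ class_lt [set x] R.
Proof.
move=> setL setR LR.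
have [s sE] := follow_strategy (fun x => `[< exists2 l, L l & no_le x l >]).
apply: contrapT => noX.
have sT b : s b -> exists2 l, L l & no_le (sign_seq s b) l.
  by rewrite sE => /asboolP.
have sF b : ~~ s b -> exists2 r, R r & no_le r (sign_seq s b).
  rewrite sE => /asboolPn nl; apply: contrapT => nr; apply: noX.
  exists (sign_seq s b); split=> [l _ Ll ->|_ r -> Rr].
    by apply: contrapT => h; apply: nl; exists l => //; apply/no_leNgt.
  by apply: contrapT => h; apply: nr; exists r => //; apply/no_leNgt.
have [a La] := is_set_len_bounded _ setL.
have [b Rb] := is_set_len_bounded _ setR.
have [c [ac bc]] : exists c, ord_le a c /\ ord_le b c.
  case: (ord_lt_total a b) => h; [exists b|exists a|exists a].
  - by split; [right|left].
  - by split; [left|left].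
  - by split; [left|right].
(* The longest common prefix of [x] and the sequence of length [c] is a truncation at some [d] below
   [c]; the sign at [d] tells the side of [x]. *)
have key x : ord_lt (len x) c -> x <> sign_seq s c ->
    exists d, ord_lt d c /\
      (if s d then no_lt x (sign_seq s c) /\ no_le x (sign_seq s d)
       else no_lt (sign_seq s c) x /\ no_le (sign_seq s d) x).
  move=> xc ne; have sub z : simpler z x -> simpler z (sign_seq s c) ->
      exists d, ord_lt d c /\ z = sign_seq s d.
    move=> zx /simpler_sign_seq zE; exists (len z); split=> //.
    exact: ord_le_lt_trans zx.1 xc.
  case: (no_lt_total x (sign_seq s c)) => // lt.
  - have [z [zx zc xz zc']] := no_lt_meet _ _ lt.
    have [d [dc zE]] := sub z zx zc; subst z; exists d; split=> //.
    case sd: (s d) => //; move/no_leNgt: zc'; case.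
    by apply/(sign_seq_lt s _ _ dc).2; rewrite sd.
  - have [z [zc zx cz zx']] := no_lt_meet _ _ lt.
    have [d [dc zE]] := sub z zx zc; subst z; exists d; split=> //.
    case sd: (s d) => //; move/no_leNgt: cz; case.
    exact/(sign_seq_lt s _ _ dc).1.
have neq x : ord_lt (len x) c -> x <> sign_seq s c.
  by move=> xc E; move: xc; rewrite E; apply: ord_lt_irr.
apply: noX; exists (sign_seq s c); split=> [l _ Ll ->|_ r -> Rr].
- have lc : ord_lt (len l) c by case: ac => [<-|]; [|apply: ord_lt_trans]; apply: La.
  have [d [_]] := key l lc (neq l lc).
  (* If [l] were above the sequence, the minus at [d] would come from some [r] in [R] that is at
     most the truncation, hence at most [l]. *)
  case: ifPn => [_ []//|/sF[r Rr rd] [_ dl]].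
  by move/no_leNgt: dl; case; apply: no_lt_le_trans rd; apply: LR.
- have rc : ord_lt (len r) c by case: bc => [<-|]; [|apply: ord_lt_trans]; apply: Rb.
  have [d [_]] := key r rc (neq r rc).
  case: ifPn => [/sT[l Ll ld] [_ dl]|_ []//].
  by move/no_leNgt: dl; case; apply: no_le_lt_trans ld _; apply: LR.
Qed.

(** * Cuts in a surreal substructure *)

Definition cut_class (T L R : set No) : set No :=
  [set y | [/\ T y, class_lt L [set y] & class_lt [set y] R]].

Definition has_cuts (T : set No) : Prop :=
  forall L R, is_set L -> is_set R -> L `<=` T -> R `<=` T -> class_lt L R ->
  exists x, is_root (cut_class T L R) x.

(** The preimage of [C] under the embedding is convex in all of [No], and the embedding carries its
    root to a root of [C]. *)
Lemma substructure_convex_root (S C : set No) : surreal_substructure S ->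
  C `<=` S -> C !=set0 -> convex_in S C -> exists x, is_root C x.
Proof.
move=> [f [fle fsim ->]] CS [c Cc] cC.
have [||x [Cx xmin]] := convex_root (f @^-1` C).
- by have [a _ fa] := CS c Cc; exists a; rewrite /= fa.
- move=> x y z /= Cx Cz _ /fle xy /fle yz; apply: cC Cx Cz _ xy yz.
  by exists y.
exists (f x); split=> // y Cy; have [a _ fa] := CS y Cy.
by rewrite -fa; apply: (fsim _ _).1; apply: xmin; rewrite /= fa.
Qed.

(** A cut is convex in [S]; it is inhabited because [L] and [R] pull back to sets of numbers that
    can be separated. *)
Lemma substructure_has_cuts (S : set No) : surreal_substructure S -> has_cuts S.
Proof.
move=> Ssub L R setL setR LS RS LR.
have cutS : cut_class S L R `<=` S by move=> y [].
apply: (substructure_convex_root S) => //; last first.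
  move=> x y z [_ Lx _] [_ _ zR] Sy xy yz; split=> [//|l _ Ll ->|_ r -> Rr].
    by apply: no_lt_le_trans xy; apply: Lx.
  by apply: no_le_lt_trans yz _; apply: zR.
have [f [fle _ SE]] := Ssub.
have flt x y : no_lt x y <-> no_lt (f x) (f y).
  split=> h; apply: contrapT => /no_leNgt.
    by move/(fle _ _).2/no_leNgt.
  by move/(fle _ _).1/no_leNgt.
(* By injectivity of [f], one chosen preimage per index exhausts the preimage of [X]. *)
have pull X : is_set X -> X `<=` S -> is_set (f @^-1` X).
  move=> [A [g ->]] XS.
  have /choice[h hg] : forall a, exists x, f x = g a.
    by move=> a; have := XS (g a); rewrite SE => -[|x _ <-]; [exists a|exists x].
  apply: (@is_set_subset A h) => x [a _ ga]; exists a => //.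
  case: (no_lt_total (h a) x) => // /flt; rewrite hg ga => /no_lt_irr //.
have [|x [Lx xR]] := between_sets _ _ (pull L setL LS) (pull R setR RS).
  by move=> l r Ll Rr; apply: (flt _ _).2; apply: LR.
exists (f x); split=> [|l _ Ll ->|_ r -> Rr]; first by rewrite SE; exists x.
  have := LS l Ll; rewrite SE => -[a _ fa]; rewrite -fa; apply: (flt _ _).1; apply: Lx => //.
  by rewrite /= fa.
have := RS r Rr; rewrite SE => -[a _ fa]; rewrite -fa; apply: (flt _ _).1; apply: xR => //.
by rewrite /= fa.
Qed.

(** * From cuts to a surreal substructure *)

(** With [prefix_right], this is the canonical cut representing [x]. *)
Definition prefix_left (x : No) : set No := [set y | simpler y x /\ no_lt y x].
Definition prefix_right (x : No) : set No := [set y | simpler y x /\ no_lt x y].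

(** Proper prefixes of [x] are truncations, indexed by the ordinals below [len x], and these are
    covered by a small family. *)
Lemma prefix_image_set (f : No -> No) (x : No) (P : set No) :
  (forall y, P y -> simpler y x /\ y <> x) -> is_set (f @` P).
Proof.
move=> Px; have [A [g gA]] := ord_initial_small (len x).
apply: (@is_set_subset A (fun a => f (sign_seq (signs x) (g a)))).
move=> _ [y /Px [yx ne] <-].
have [a _ ga] := gA _ (simpler_neq_len _ _ yx ne).
exists a => //; rewrite ga; congr f; symmetry.
by apply: (simpler_sign_seq _ _ (len x)); rewrite sign_seq_signs.
Qed.

Lemma simpler_total x y z : simpler x z -> simpler y z ->
  simpler x y \/ simpler y x.
Proof.
move=> xz yz; rewrite -(sign_seq_signs z) in xz yz.
rewrite (simpler_sign_seq _ _ _ xz) (simpler_sign_seq _ _ _ yz).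
by case: (ord_lt_total (len x) (len y)) => h; [left|left|right];
  apply: sign_seq_simpler; rewrite /ord_le; auto.
Qed.

(** If [g a] were below [a], monotonicity would put [g (g a)] below [g a], against induction at
    [g a]. *)
Lemma ord_increasing_ge (g : Ord -> Ord) :
  (forall a b, ord_lt a b -> ord_lt (g a) (g b)) -> forall a, ord_le a (g a).
Proof.
move=> gI; apply: (well_founded_ind ord_lt_wf) => a IH.
apply/ord_leNgt => ga.
by move/ord_leNgt: (IH _ ga); apply; apply: gI.
Qed.

Lemma no_lt_neq x y : no_lt x y -> x <> y.
Proof. by move=> xy E; move: xy; rewrite E; apply: no_lt_irr. Qed.

(* Conway's recursion f {L | R} = {f L | f R}_T over the canonical cut of each
   number. *)
Lemma has_cuts_map (T : set No) : has_cuts T ->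
  exists f : No -> No, forall x,
    is_root (cut_class T (f @` prefix_left x) (f @` prefix_right x)) (f x).
Proof.
move=> cutT.
(* The empty sequence, serving only as a default value. *)
have d : No by exact: sign_seq xpredT (rank (Node (of_void tree))).
have /choice[root rootP] : forall C : set No, exists r,
    (exists x, is_root C x) -> is_root C r.
  move=> C; have [[x Cx]|nC] := pselect (exists x, is_root C x).
    by exists x.
  by exists d.
have wf := wf_inverse_image _ _ _ len ord_lt_wf.
have [f fE] := wf_rec wf d (fun x f =>
  root (cut_class T (f @` prefix_left x) (f @` prefix_right x))).
exists f.
have {}fE x : f x = root (cut_class T (f @` prefix_left x) (f @` prefix_right x)).
  rewrite {1}fE; congr (root (cut_class T _ _)); apply: eq_imagel => y [yx lt].
    case: pselect => // -[]; apply: simpler_neq_len => //; exact: no_lt_neq.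
  by case: pselect => // -[]; apply: simpler_neq_len => // /esym; apply: no_lt_neq.
apply: (well_founded_ind wf) => x IH.
have {}IH y : simpler y x -> y <> x ->
    is_root (cut_class T (f @` prefix_left y) (f @` prefix_right y)) (f y).
  by move=> yx ne; apply: IH; apply: simpler_neq_len.
have xl y : prefix_left x y -> simpler y x /\ y <> x.
  by move=> [yx lt]; split=> //; apply: no_lt_neq.
have xr y : prefix_right x y -> simpler y x /\ y <> x.
  by move=> [yx lt]; split=> // /esym; apply: no_lt_neq.
rewrite fE; apply: rootP; apply: cutT.
- exact: prefix_image_set xl.
- exact: prefix_image_set xr.
- by move=> _ [y /xl [yx ne] <-]; have [[]] := IH y yx ne.
- by move=> _ [y /xr [yx ne] <-]; have [[]] := IH y yx ne.
- move=> _ _ [y ly <-] [z rz <-].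
  have [[yx yne] [zx zne]] := (xl y ly, xr z rz).
  have yz : no_lt y z := no_lt_trans _ _ _ ly.2 rz.2.
  (* Two prefixes of [x] are comparable, and the simpler one occurs in the canonical cut of the
     other. *)
  case: (simpler_total _ _ _ yx zx) => h.
  + by have [[_ L _] _] := IH z zx zne; apply: L => //; exists y.
  + by have [[_ _ R] _] := IH y yx yne; apply: R => //; exists z.
Qed.

(** Monotonicity passes through longest common prefixes. Simplicity is preserved because [f y] lies
    in the cut with root [f x] when [x] is a prefix of [y]. *)
Lemma has_cuts_substructure (T : set No) : has_cuts T -> surreal_substructure T.
Proof.
move=> cutT; have [f fP] := has_cuts_map T cutT.
have fT x : T (f x) by have [[]] := fP x.
have f_left x y : simpler y x -> no_lt y x -> no_lt (f y) (f x).
  by move=> yx lt; have [[_ L _] _] := fP x; apply: L => //; exists y.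
have f_right x y : simpler y x -> no_lt x y -> no_lt (f x) (f y).
  by move=> yx lt; have [[_ _ R] _] := fP x; apply: R => //; exists y.
have f_lt x y : no_lt x y -> no_lt (f x) (f y).
  move=> xy; have [z [zx zy]] := no_lt_meet _ _ xy.
  move=> [xz|xz] [zy'|zy']; [by case: (no_lt_neq _ _ xy); rewrite xz| | |].
  - by rewrite xz; apply: f_left.
  - by rewrite -zy'; apply: f_right.
  - by apply: no_lt_trans (f_left _ _ zy zy'); apply: f_right.
have f_le x y : no_le x y <-> no_le (f x) (f y).
  split=> [[->|/f_lt]|]; [by left|by right|].
  by move=> /no_leNgt h; apply/no_leNgt => /f_lt.
have f_sim x y : simpler x y -> simpler (f x) (f y).
  move=> xy; have [_] := fP x; apply; split=> // [_ _ [z [zx lt] <-] ->|].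
    by apply: f_lt; apply: simpler_lt_trans lt.
  by move=> _ _ -> [z [zx lt] <-]; apply: f_lt; apply: simpler_gt_trans lt.
have f_inj x y : f x = f y -> x = y.
  by move=> E; case: (no_lt_total x y) => // /f_lt; rewrite E => /no_lt_irr.
exists f; split=> // [x y|].
  split=> [|fxy]; first exact: f_sim.
  have no_back : simpler y x -> simpler x y.
    move=> /f_sim fyx; rewrite (f_inj x y); first exact: simpler_refl.
    exact: simpler_anti.
  case: (no_lt_total x y) => [lt|->|lt]; last 1 first.
  - have [z [zy zx [yz|yz] [zx'|zx']]] := no_lt_meet _ _ lt.
    + by rewrite -zx'.
    + by apply: no_back; rewrite yz.
    + by rewrite -zx'.
    (* Here [f z] is a prefix of [f x], itself a prefix of [f y], so [f z] lies on the same side of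
       both, against [y < z < x]. *)
    + have := simpler_lt_trans _ _ _ (f_sim _ _ zx) fxy (f_lt _ _ zx').
      by move/(no_lt_trans _ _ _ (f_lt _ _ yz))/no_lt_irr.
  - have [z [zx zy [xz|xz] [zy'|zy']]] := no_lt_meet _ _ lt.
    + by rewrite xz.
    + by rewrite xz.
    + by apply: no_back; rewrite -zy'.
    + have := simpler_gt_trans _ _ _ (f_sim _ _ zx) fxy (f_lt _ _ xz).
      by move=> h; case: (no_lt_irr _ (no_lt_trans _ _ _ (f_lt _ _ zy') h)).
  - exact: simpler_refl.
apply/seteqP; split=> [t Tt|_ [x _ <-]//].
(* Descend towards t; every f (X b) met before t is a prefix of t, which bounds
   the length of the descent. *)
have [s sE] := follow_strategy (fun x => `[< no_lt (f x) t >]).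
apply: contrapT => nt.
have ne b : f (sign_seq s b) <> t by move=> E; apply: nt; exists (sign_seq s b).
have sT b : s b -> no_lt (f (sign_seq s b)) t by rewrite sE => /asboolP.
have sF b : ~~ s b -> no_lt t (f (sign_seq s b)).
  rewrite sE => /asboolPn /no_leNgt [E|//].
  by case: (ne b).
(* The signs of [s] record the side of [t], so [t] lies in the cut whose root is
   [f (sign_seq s b)]. *)
have sub b : simpler (f (sign_seq s b)) t.
  have [_] := fP (sign_seq s b); apply; split=> // [_ _ [z [zx lt] <-] ->|].
    have zb := simpler_neq_len _ _ zx (no_lt_neq _ _ lt).
    rewrite (simpler_sign_seq _ _ _ zx) in lt *.
    by apply: sT; apply/(sign_seq_lt s _ _ zb).1.
  move=> _ _ -> [z [zx lt] <-].
  have zb := simpler_neq_len _ _ zx (nesym (no_lt_neq _ _ lt)).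
  rewrite (simpler_sign_seq _ _ _ zx) in lt *.
  by apply: sF; apply/(sign_seq_lt s _ _ zb).2.
have len_inc a b : ord_lt a b ->
    ord_lt (len (f (sign_seq s a))) (len (f (sign_seq s b))).
  move=> ab; apply: simpler_neq_len.
    by apply: f_sim; apply: sign_seq_simpler; right.
  by move=> /f_inj /(congr1 len) /= E; move: ab; rewrite E; apply: ord_lt_irr.
(* For [b] above [len t], the image of the truncation at [b] has length at least [b], too long for a
   prefix of [t]. *)
have [b tb] := @ord_small_bounded unit (fun=> len t).
have bb := ord_increasing_ge _ len_inc b.
have /ord_leNgt := (sub b).1; apply; have := tb tt.
by case: bb => [<-//|bb tb']; apply: ord_lt_trans bb.
Qed.

(** * Order between members of a convex partition *)

(** If [b] in [D] were at most [a] in [C], then [x < y < a] would put [y] in [C], or [b <= a <= y]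
    would put [a] in [D]. *)
Lemma convex_lt (S C D : set No) (x y : No) :
  C `<=` S -> D `<=` S -> convex_in S C -> convex_in S D -> ~ (C `&` D !=set0) ->
  C x -> D y -> no_lt x y -> class_lt C D.
Proof.
move=> CS DS cC cD CD Cx Dy xy a b Ca Db.
apply: contrapT => /no_leNgt ba; apply: CD.
have [ay|/no_leNgt ya] := pselect (no_lt y a).
  by exists y; split=> //; apply: (cC x y a) => //; [apply: DS|right|right].
by exists a; split=> //; apply: (cD b a y) => //; apply: CS.
Qed.

Lemma memberP {S : set No} {Pi : set (set No)} {x : No} :
  convex_partition S Pi -> S x -> Pi (member Pi x) /\ member Pi x x.
Proof.
move=> [_ PiI PiS] Sx; have [C PiC Cx] := PiS x Sx.
suff -> : member Pi x = C by [].
apply/seteqP; split=> [y [D [PiD Dx] Dy]|y Cy]; last by exists C.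
by rewrite (PiI C D) //; exists x.
Qed.

Lemma member_eq {S : set No} {Pi : set (set No)} {x y : No} :
  convex_partition S Pi -> S x -> S y ->
  member Pi x `&` member Pi y !=set0 -> member Pi x = member Pi y.
Proof.
move=> PiP Sx Sy; have [_ PiI _] := PiP.
by apply: PiI; [apply: (memberP PiP Sx).1 | apply: (memberP PiP Sy).1].
Qed.

Lemma member_lt {S : set No} {Pi : set (set No)} {x y : No} :
  convex_partition S Pi -> S x -> S y -> member Pi x <> member Pi y ->
  no_lt x y -> class_lt (member Pi x) (member Pi y).
Proof.
move=> PiP Sx Sy ne; have [PiC _ _] := PiP.
have [[Px Cx] [Py Cy]] := (memberP PiP Sx, memberP PiP Sy).
have [[_ xS xc] [_ yS yc]] := (PiC _ Px, PiC _ Py).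
by apply: (convex_lt S) => // /(member_eq PiP Sx Sy).
Qed.

Lemma Smp_member_inj {S : set No} {Pi : set (set No)} {x y : No} :
  Smp S Pi x -> Smp S Pi y -> member Pi x = member Pi y -> x = y.
Proof.
move=> [_ [Cx xmin]] [_ [Cy ymin]] E.
by apply: simpler_anti; [apply: xmin; rewrite E | apply: ymin; rewrite -E].
Qed.

Lemma Smp_member_lt {S : set No} {Pi : set (set No)} {x y : No} :
  convex_partition S Pi -> Smp S Pi x -> Smp S Pi y -> no_lt x y ->
  class_lt (member Pi x) (member Pi y).
Proof.
move=> PiP sx sy xy; apply: (member_lt PiP sx.1 sy.1 _ xy).
by move=> /(Smp_member_inj sx sy); apply: no_lt_neq.
Qed.

(** * Cuts of simple elements *)

Lemma Smp_cut (S : set No) (Pi : set (set No)) (tPi : No -> set No)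
  (S_sub : surreal_substructure S)
  (Pi_partition : convex_partition S Pi)
  (tPi_cofinal : forall x, S x ->
    [/\ is_set (tPi x), tPi x `<=` member Pi x,
        cofinal (member Pi x) (tPi x) & coinitial (member Pi x) (tPi x)])
  (L R : set No) :
  is_set L -> is_set R -> L `<=` Smp S Pi -> R `<=` Smp S Pi ->
  class_lt L R ->
  exists z : No,
    is_cut S (\bigcup_(x in L) tPi x) (\bigcup_(x in R) tPi x) z /\
    is_cut (Smp S Pi) L R z.
Proof.
move=> setL setR LS RS LR; have PiP := Pi_partition.
have memS x : S x -> member Pi x `<=` S.
  by move=> Sx; have [PiC _ _] := PiP; have [] := PiC _ (memberP PiP Sx).1.
have tPi_sub x : S x -> tPi x `<=` member Pi x by move=> /tPi_cofinal [].
have sets X : is_set X -> X `<=` Smp S Pi -> is_set (\bigcup_(x in X) tPi x).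
  by move=> Xs XS; apply: is_set_bigcup => // x /XS [/tPi_cofinal []].
have subS X : X `<=` Smp S Pi -> \bigcup_(x in X) tPi x `<=` S.
  by move=> XS y [x /XS [Sx _] /(tPi_sub x Sx) /(memS x Sx)].
have tLR : class_lt (\bigcup_(x in L) tPi x) (\bigcup_(x in R) tPi x).
  move=> a b [l Ll la] [r Rr rb].
  have [sl sr] := (LS l Ll, RS r Rr).
  apply: (Smp_member_lt PiP sl sr (LR _ _ Ll Rr)); apply: tPi_sub => //.
    exact: sl.1.
  exact: sr.1.
have [z [[Sz Lz zR] zmin]] := substructure_has_cuts S S_sub _ _
  (sets L setL LS) (sets R setR RS) (subS L LS) (subS R RS) tLR.
have [Pz Cz] := memberP PiP Sz.
have mLz l : L l -> class_lt (member Pi l) (member Pi z).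
  move=> Ll; have [Sl _] := LS l Ll; have [_ _ cof _] := tPi_cofinal l Sl.
  (* Cofinality lifts [z] above all of [member Pi l], so [z] is outside it and the two members are
     ordered. *)
  have lz c : member Pi l c -> no_lt c z.
    move=> /cof [a la ca]; apply: no_le_lt_trans ca _.
    by apply: Lz => //; exists l.
  apply: (member_lt PiP Sl Sz); last exact: lz (memberP PiP Sl).2.
  by move=> E; apply: (no_lt_irr z); apply: lz; rewrite E.
have mzR r : R r -> class_lt (member Pi z) (member Pi r).
  move=> Rr; have [Sr _] := RS r Rr; have [_ _ _ coi] := tPi_cofinal r Sr.
  have zr c : member Pi r c -> no_lt z c.
    move=> /coi [a ra ac]; apply: no_lt_le_trans ac.
    by apply: zR => //; exists r.
  apply: (member_lt PiP Sz Sr); last exact: zr (memberP PiP Sr).2.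
  by move=> E; apply: (no_lt_irr z); apply: zr; rewrite -E.
(* The root w of Pi[z] lies in the cut that defines z. *)
have [w [Cw wmin]] : exists w, is_root (member Pi z) w.
  have [PiC _ _] := PiP; have [ne CS cC] := PiC _ Pz.
  exact: substructure_convex_root CS ne cC.
have zw : z = w.
  apply: simpler_anti (wmin z Cz); apply: zmin; split; first exact: memS Cw.
  - move=> a _ [l Ll la] ->; apply: (mLz l Ll) => //.
    by apply: tPi_sub la; have [] := LS l Ll.
  - move=> _ b -> [r Rr rb]; apply: (mzR r Rr) => //.
    by apply: tPi_sub rb; have [] := RS r Rr.
subst w; exists z; split; first by split=> //; apply: sets.
split=> //; split.
  split=> // [l _ Ll ->|_ r -> Rr].
  - by apply: (mLz l Ll) => //; have [_ []] := LS l Ll.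
  - by apply: (mzR r Rr) => //; have [_ []] := RS r Rr.
(* A simple [y] between [L] and [R] has its member between theirs, so it lies in the cut of [S]
   whose root is [z]. *)
move=> y [sy Ly yR]; apply: zmin; split; first exact: sy.1.
- move=> a _ [l Ll la] ->; have sl := LS l Ll.
  apply: (Smp_member_lt PiP sl sy (Ly _ _ Ll erefl)); last exact: sy.2.1.
  exact: (tPi_sub l sl.1).
- move=> _ b -> [r Rr rb]; have sr := RS r Rr.
  apply: (Smp_member_lt PiP sy sr (yR _ _ erefl Rr)); first exact: sy.2.1.
  exact: (tPi_sub r sr.1).
Qed.

Theorem theorem6p7 (S : set No) (Pi : set (set No)) (tPi : No -> set No)
  (S_sub : surreal_substructure S)
  (Pi_partition : convex_partition S Pi)
  (Pi_thin : thin Pi)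
  (tPi_cofinal : forall x, S x ->
    [/\ is_set (tPi x), tPi x `<=` member Pi x,
        cofinal (member Pi x) (tPi x) & coinitial (member Pi x) (tPi x)])
  (tPi_eq : forall x y, S x -> S y ->
    (tPi x = tPi y <-> member Pi x = member Pi y)) :
  surreal_substructure (Smp S Pi) /\
  forall L R : set No,
    is_set L -> is_set R -> L `<=` Smp S Pi -> R `<=` Smp S Pi ->
    class_lt L R ->
    exists z : No,
      is_cut S (\bigcup_(x in L) tPi x) (\bigcup_(x in R) tPi x) z /\
      is_cut (Smp S Pi) L R z.

Proof.
have cuts := @Smp_cut S Pi tPi S_sub Pi_partition tPi_cofinal.
split=> //; apply: has_cuts_substructure => L R setL setR LS RS LR.
by have [z [_ [_ _ _ zroot]]] := cuts L R setL setR LS RS LR; exists z.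
Qed.
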